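(* Let $E$ be a uniformly smooth real Banach space, $D\subseteq E$ a nonempty closed convex subset, $T:D\to D$ a nonexpansive mapping with $F(T)\neq\emptyset$, and $x_0,u\in D$. Let $\{u_n\},\{v_n\}$ be bounded sequences in $D$ and let $\alpha_n,\gamma_n,\beta_n,\delta_n\ge0$ satisfy $0<\alpha_n+\gamma_n\le1$, $0<\beta_n+\delta_n\le1$, $\alpha_n\to0$, $\sum_{n=0}^\infty\alpha_n=\infty$, $\sum_{n=0}^\infty\gamma_n<\infty$, $\sum_{n=0}^\infty\delta_n<\infty$ and $\frac{\gamma_n}{\alpha_n+\gamma_n}\to0$. Define for $n\ge0$ $$y_n=\beta_nx_n+(1-\beta_n-\delta_n)Tx_n+\delta_nv_n,\qquad x_{n+1}=\alpha_nu+(1-\alpha_n-\gamma_n)Ty_n+\gamma_nu_n.$$ Assume $\{x_n\}$ is bounded and $\|Tx_n-x_n\|\to0$. Then $\{x_n\}$ converges strongly to $Q(u)$, where $u$ is regarded as the constant map $D\to D$, $x\mapsto u$.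
   Context: $F(T)=\{x\in D: Tx=x\}$ denotes the fixed point set of $T$. $\Pi_D$ denotes the set of contractions on $D$: maps $f:D\to D$ for which there is $\alpha\in(0,1)$ with $\|f(x)-f(y)\|\le\alpha\|x-y\|$ for all $x,y\in D$ (constant maps belong to $\Pi_D$). For $f\in\Pi_D$ and $t\in(0,1)$, let $x_t\in D$ be the unique solution of $x_t=tf(x_t)+(1-t)Tx_t$. When $E$ is uniformly smooth and $F(T)\neq\emptyset$, the strong limit $\lim_{t\to0^+}x_t$ exists and lies in $F(T)$ (a known result of Xu); the map $Q:\Pi_D\to F(T)$ is defined by $Q(f):=\lim_{t\to0^+}x_t$. *)

(* Defs.v *)
From Stdlib Require Import Reals Lra.
Open Scope R_scope.

Record NormedSpace := {
  ns_car :> Type;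
  ns_zero : ns_car;
  ns_add : ns_car -> ns_car -> ns_car;
  ns_opp : ns_car -> ns_car;
  ns_scal : R -> ns_car -> ns_car;
  ns_norm : ns_car -> R;
  ns_addA : forall x y z, ns_add x (ns_add y z) = ns_add (ns_add x y) z;
  ns_addC : forall x y, ns_add x y = ns_add y x;
  ns_add0 : forall x, ns_add x ns_zero = x;
  ns_addN : forall x, ns_add x (ns_opp x) = ns_zero;
  ns_scalA : forall a b x, ns_scal a (ns_scal b x) = ns_scal (a * b) x;
  ns_scal1 : forall x, ns_scal 1 x = x;
  ns_scalDr : forall a x y, ns_scal a (ns_add x y) = ns_add (ns_scal a x) (ns_scal a y);
  ns_scalDl : forall a b x, ns_scal (a + b) x = ns_add (ns_scal a x) (ns_scal b x);
  ns_norm_ge0 : forall x, 0 <= ns_norm x;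
  ns_norm_eq0 : forall x, ns_norm x = 0 -> x = ns_zero;
  ns_normZ : forall a x, ns_norm (ns_scal a x) = Rabs a * ns_norm x;
  ns_normD : forall x y, ns_norm (ns_add x y) <= ns_norm x + ns_norm y
}.

Arguments ns_zero {n}.
Arguments ns_add {n}.
Arguments ns_opp {n}.
Arguments ns_scal {n}.
Arguments ns_norm {n}.

Definition ns_sub {E : NormedSpace} (x y : E) : E := ns_add x (ns_opp y).

Definition seq_cv {E : NormedSpace} (x : nat -> E) (l : E) : Prop :=
  forall eps, eps > 0 -> exists N, forall n, (n >= N)%nat -> ns_norm (ns_sub (x n) l) < eps.

Definition seq_cauchy {E : NormedSpace} (x : nat -> E) : Prop :=
  forall eps, eps > 0 -> exists N, forall n m, (n >= N)%nat -> (m >= N)%nat ->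
    ns_norm (ns_sub (x n) (x m)) < eps.

Definition complete (E : NormedSpace) : Prop :=
  forall x : nat -> E, seq_cauchy x -> exists l, seq_cv x l.

(* Uniform smoothness: the modulus of smoothness
   rho(tau) = sup {(||x+tau y|| + ||x - tau y||)/2 - 1 : ||x|| = ||y|| = 1}
   satisfies rho(tau)/tau -> 0 as tau -> 0+; written out: for each eps > 0
   there is delta > 0 with rho(tau) <= eps * tau for 0 < tau < delta. *)
Definition uniformly_smooth (E : NormedSpace) : Prop :=
  forall eps, eps > 0 -> exists delta, delta > 0 /\
    forall tau, 0 < tau < delta ->
    forall x y : E, ns_norm x = 1 -> ns_norm y = 1 ->
      (ns_norm (ns_add x (ns_scal tau y)) + ns_norm (ns_sub x (ns_scal tau y))) / 2 - 1
        <= eps * tau.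

Definition ns_closed_set {E : NormedSpace} (D : E -> Prop) : Prop :=
  forall (x : nat -> E) (l : E), (forall n, D (x n)) -> seq_cv x l -> D l.

Definition ns_convex_set {E : NormedSpace} (D : E -> Prop) : Prop :=
  forall x y (t : R), D x -> D y -> 0 <= t <= 1 ->
    D (ns_add (ns_scal t x) (ns_scal (1 - t) y)).

Definition nonexpansive_on {E : NormedSpace} (D : E -> Prop) (T : E -> E) : Prop :=
  forall x y, D x -> D y -> ns_norm (ns_sub (T x) (T y)) <= ns_norm (ns_sub x y).

Definition bounded_seq {E : NormedSpace} (x : nat -> E) : Prop :=
  exists M, forall n, ns_norm (x n) <= M.

Definition fixed_point {E : NormedSpace} (D : E -> Prop) (T : E -> E) (p : E) : Prop :=
  D p /\ T p = p.

(* Main.v *)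
Require Import Defs.
From Stdlib Require Import Reals Lra Lia Classical ClassicalEpsilon List.
Open Scope R_scope.

(* The duality map is never introduced: its inequalities are replaced by
   |x + y| + |x - y| <= 2 |x| + eps |y| for |y| <= delta |x|, a form of uniform
   smoothness.  It yields a Smulian-type intersection property for nested closed
   convex bounded sets, then normal structure, then fixed points of nonexpansive
   maps.  The points minimizing the upper limit of |x_t - z| as t -> 0+ form an
   invariant set, hence contain a fixed point q of T, and smoothness shows that
   the minimum is 0: this is the convergence x_t -> q.  Comparing x_n with x_t for
   small t shows that subtracting a small multiple of u - q from x_n - q hardly decreases
   its norm, whence, up to small errors,
   |x_{n+1} - q| <= (1 - alpha_n) |x_n - q| + M (gamma_n + delta_n). *)

Local Notation "x +v y" := (ns_add x y) (at level 50, left associativity).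
Local Notation "x -v y" := (ns_sub x y) (at level 50, left associativity).
Local Notation "a *v x" := (ns_scal a x) (at level 40, left associativity).
Local Notation "⟦ x ⟧" := (ns_norm x) (at level 0, x at level 99).

(** * Linear identities and norm estimates *)

(** Syntax for proving linear identities by reflection: [vden_lin] brings every expression to the
    form of coefficients times atoms, after which only real coefficients have to be compared. *)
Inductive vexp :=
  | VAtom (n : nat)
  | VZero
  | VAdd (e f : vexp)
  | VSub (e f : vexp)
  | VOpp (e : vexp)
  | VScal (a : R) (e : vexp).

Fixpoint vden {E : NormedSpace} (env : list E) (e : vexp) : E :=
  match e with
  | VAtom n => nth n env ns_zero
  | VZero => ns_zero
  | VAdd e f => vden env e +v vden env f
  | VSub e f => vden env e -v vden env f
  | VOpp e => ns_opp (vden env e)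
  | VScal a e => a *v vden env e
  end.

Fixpoint vcoef (e : vexp) (n : nat) : R :=
  match e with
  | VAtom k => if Nat.eqb n k then 1 else 0
  | VZero => 0
  | VAdd e f => vcoef e n + vcoef f n
  | VSub e f => vcoef e n - vcoef f n
  | VOpp e => - vcoef e n
  | VScal a e => a * vcoef e n
  end.

Fixpoint vlin {E : NormedSpace} (env : list E) (c : nat -> R) : E :=
  match env with
  | nil => ns_zero
  | x :: l => c 0%nat *v x +v vlin l (fun n => c (S n))
  end.

(** A conjunction built by recursion, rather than a bounded quantifier, so that [cbv] turns it into
    one real equation per atom. *)
Fixpoint vcoef_eq (l : nat) (c d : nat -> R) : Prop :=
  match l with
  | O => True
  | S l => c 0%nat = d 0%nat /\ vcoef_eq l (fun n => c (S n)) (fun n => d (S n))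
  end.

Lemma add_cancel (E : NormedSpace) (x y z : E) : x +v z = y +v z -> x = y.
Proof.
  intro H. rewrite <- (ns_add0 E x), <- (ns_add0 E y), <- (ns_addN E z).
  rewrite !ns_addA, H. reflexivity.
Qed.

Lemma scal0 (E : NormedSpace) (x : E) : 0 *v x = ns_zero.
Proof.
  apply (add_cancel _ _ _ (0 *v x)). rewrite <- ns_scalDl, Rplus_0_r.
  rewrite ns_addC, ns_add0. reflexivity.
Qed.

Lemma scalN1 (E : NormedSpace) (x : E) : ns_opp x = (-1) *v x.
Proof.
  apply (add_cancel _ _ _ x).
  rewrite ns_addC, ns_addN. rewrite <- (ns_scal1 E x) at 2.
  rewrite <- ns_scalDl. replace (-1 + 1) with 0 by ring. now rewrite scal0.
Qed.

Lemma vlin_ext (E : NormedSpace) (env : list E) :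
  forall c d, vcoef_eq (length env) c d -> vlin env c = vlin env d.
Proof.
  induction env as [|x l IH]; intros c d H; simpl in *; [easy|].
  destruct H as [H0 H]. now rewrite H0, (IH _ _ H).
Qed.

Lemma vlin_ext_all (E : NormedSpace) (env : list E) (c d : nat -> R) :
  (forall n, c n = d n) -> vlin env c = vlin env d.
Proof.
  revert c d. induction env as [|x l IH]; intros c d H; simpl; [easy|].
  rewrite H. f_equal. apply IH. intro n. apply H.
Qed.

Lemma vlin_zero (E : NormedSpace) (env : list E) : vlin env (fun _ => 0) = ns_zero.
Proof.
  induction env as [|x l IH]; simpl; [easy|]. now rewrite IH, scal0, ns_add0.
Qed.

(** The single shape [a * c n + d n] covers the sums, differences, opposites and multiples in
    [vden_lin]. *)
Lemma vlin_comb (E : NormedSpace) (env : list E) : forall a (c d : nat -> R),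
  a *v vlin env c +v vlin env d = vlin env (fun n => a * c n + d n).
Proof.
  induction env as [|x l IH]; intros a c d; simpl.
  - rewrite ns_add0. rewrite <- (scal0 E ns_zero), ns_scalA. now rewrite Rmult_0_r.
  - rewrite <- (IH a (fun n => c (S n)) (fun n => d (S n))).
    rewrite ns_scalDl, ns_scalDr, <- ns_scalA.
    rewrite <- !ns_addA. f_equal. rewrite !ns_addA. f_equal. apply ns_addC.
Qed.

Lemma vden_lin (E : NormedSpace) (env : list E) (e : vexp) :
  vden env e = vlin env (vcoef e).
Proof.
  induction e as [n| |e IHe f IHf|e IHe f IHf|e IHe|a e IHe]; simpl.
  - revert n; induction env as [|x l IH]; intros [|n]; simpl; try easy.
    + rewrite ns_scal1, (vlin_zero E l). now rewrite ns_add0.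
    + rewrite IH, scal0. rewrite ns_addC, ns_add0. now apply vlin_ext_all.
  - symmetry. apply vlin_zero.
  - rewrite IHe, IHf, <- (ns_scal1 E (vlin env (vcoef e))), vlin_comb.
    apply vlin_ext_all. intro; ring.
  - unfold ns_sub. rewrite IHe, IHf, scalN1, ns_addC, vlin_comb.
    apply vlin_ext_all. intro; ring.
  - rewrite IHe, scalN1, <- (ns_add0 E (_ *v _)), <- (vlin_zero E env), vlin_comb.
    apply vlin_ext_all. intro; ring.
  - rewrite IHe, <- (ns_add0 E (_ *v _)), <- (vlin_zero E env), vlin_comb.
    apply vlin_ext_all. intro; ring.
Qed.

Lemma vden_eq (E : NormedSpace) (env : list E) (e f : vexp) :
  vcoef_eq (length env) (vcoef e) (vcoef f) -> vden env e = vden env f.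
Proof. intro H. rewrite !vden_lin. now apply vlin_ext. Qed.

Ltac v_index x l :=
  lazymatch l with
  | cons ?y ?l' =>
      lazymatch constr:((x, y)) with
      | (?z, ?z) => constr:(O)
      | _ => let n := v_index x l' in constr:(S n)
      end
  end.

Ltac v_insert x l :=
  let rec mem l' :=
    lazymatch l' with
    | nil => constr:(false)
    | cons ?y ?l'' =>
        lazymatch constr:((x, y)) with
        | (?z, ?z) => constr:(true)
        | _ => mem l''
        end
    end in
  let b := mem l in
  lazymatch b with true => l | false => constr:(cons x l) end.

Ltac v_atoms t l :=
  lazymatch t with
  | ns_zero => l
  | ns_add ?a ?b => let l := v_atoms a l in v_atoms b l
  | ns_sub ?a ?b => let l := v_atoms a l in v_atoms b l
  | ns_opp ?a => v_atoms a l
  | ns_scal _ ?a => v_atoms a l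
  | _ => v_insert t l
  end.

Ltac v_reify t l :=
  lazymatch t with
  | ns_zero => constr:(VZero)
  | ns_add ?a ?b => let a := v_reify a l in let b := v_reify b l in constr:(VAdd a b)
  | ns_sub ?a ?b => let a := v_reify a l in let b := v_reify b l in constr:(VSub a b)
  | ns_opp ?a => let a := v_reify a l in constr:(VOpp a)
  | ns_scal ?r ?a => let a := v_reify a l in constr:(VScal r a)
  | _ => let n := v_index t l in constr:(VAtom n)
  end.

Ltac vec :=
  lazymatch goal with
  | |- @eq (ns_car ?E) ?s ?t =>
      let l := v_atoms s (@nil (ns_car E)) in
      let l := v_atoms t l in
      let e := v_reify s l in
      let f := v_reify t l in
      change (vden l e = vden l f); apply vden_eq;
      cbv [vcoef vcoef_eq length Nat.eqb];
      repeat split; try ring; try (field; lra)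
  end.

Section Norm.
Context {E : NormedSpace}.
Implicit Types x y z : E.

Lemma norm_comb x y z a b :
  0 <= a -> 0 <= b -> x = a *v y +v b *v z -> ⟦x⟧ <= a * ⟦y⟧ + b * ⟦z⟧.
Proof.
  intros Ha Hb ->. eapply Rle_trans; [apply ns_normD|].
  rewrite !ns_normZ, !Rabs_pos_eq by easy. lra.
Qed.

Lemma norm_zero : ⟦@ns_zero E⟧ = 0.
Proof. rewrite <- (scal0 E ns_zero), ns_normZ, Rabs_R0. ring. Qed.

Lemma norm_scal x a : 0 <= a -> ⟦a *v x⟧ = a * ⟦x⟧.
Proof. intro Ha. now rewrite ns_normZ, Rabs_pos_eq. Qed.

Lemma norm_sub_comm x y : ⟦x -v y⟧ = ⟦y -v x⟧.
Proof.
  replace (x -v y) with ((-1) *v (y -v x)) by vec.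
  rewrite ns_normZ, Rabs_left by lra. ring.
Qed.

Lemma norm_sub_trans y x z : ⟦x -v z⟧ <= ⟦x -v y⟧ + ⟦y -v z⟧.
Proof.
  assert (H := norm_comb (x -v z) (x -v y) (y -v z) 1 1 ltac:(lra) ltac:(lra) ltac:(vec)).
  lra.
Qed.

Lemma sub_norm0 x y : ⟦x -v y⟧ <= 0 -> x = y.
Proof.
  intro H. assert (H0 : x -v y = ns_zero).
  { apply ns_norm_eq0. assert (H1 := ns_norm_ge0 E (x -v y)). lra. }
  replace x with ((x -v y) +v y) by vec. rewrite H0. vec.
Qed.

Lemma ball_convex z r : ns_convex_set (fun x => ⟦x -v z⟧ <= r).
Proof.
  intros x y t Hx Hy Ht.
  assert (H := norm_comb (t *v x +v (1 - t) *v y -v z) (x -v z) (y -v z) t (1 - t)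
                 ltac:(lra) ltac:(lra) ltac:(vec)). nra.
Qed.

Lemma ball_closed z r : ns_closed_set (fun x => ⟦x -v z⟧ <= r).
Proof.
  intros x l Hx Hl. apply Rnot_lt_le. intro H.
  destruct (Hl (⟦l -v z⟧ - r) ltac:(lra)) as [N HN].
  specialize (HN N (le_n N)). specialize (Hx N).
  assert (H1 := norm_sub_trans (x N) l z). rewrite (norm_sub_comm l (x N)) in H1. lra.
Qed.

Lemma convex_and (C C' : E -> Prop) :
  ns_convex_set C -> ns_convex_set C' -> ns_convex_set (fun x => C x /\ C' x).
Proof. intros H H' x y t [] [] Ht. split; [apply H|apply H']; easy. Qed.

Lemma closed_and (C C' : E -> Prop) :
  ns_closed_set C -> ns_closed_set C' -> ns_closed_set (fun x => C x /\ C' x).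
Proof.
  intros H H' x l Hx Hl. split; [apply (H x)|apply (H' x)]; try easy; intro n; apply Hx.
Qed.

(** Homogeneous form of the definition: apply it to the unit vectors x/|x| and y/|y| with tau =
    |y|/|x|, then multiply by 2|x|. Once y is nonzero, the bound on |y| forces x to be nonzero. *)
Lemma smooth_le : uniformly_smooth E -> forall eps, eps > 0 -> exists delta, delta > 0 /\
  forall x y, ⟦y⟧ <= delta * ⟦x⟧ -> ⟦x +v y⟧ + ⟦x -v y⟧ <= 2 * ⟦x⟧ + eps * ⟦y⟧.
Proof.
  intros Hus eps He. destruct (Hus (eps / 2) ltac:(lra)) as [d [Hd H]].
  exists (d / 2). split; [lra|]. intros x y Hxy.
  assert (Hx := ns_norm_ge0 E x). assert (Hy := ns_norm_ge0 E y).
  destruct (Req_dec (⟦y⟧) 0) as [Hy0|Hy0].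
  { assert (y = ns_zero) as -> by now apply ns_norm_eq0.
    replace (x +v ns_zero) with x by vec. replace (x -v ns_zero) with x by vec. rewrite Hy0. lra. }
  assert (Hx0 : 0 < ⟦x⟧) by nra. clear Hx.
  set (a := ⟦x⟧) in *. set (b := ⟦y⟧) in *.
  assert (Ha : 0 < / a) by now apply Rinv_0_lt_compat.
  assert (Hb : 0 < / b) by (apply Rinv_0_lt_compat; lra).
  assert (Hdiv : b / a <= d / 2).
  { apply (Rmult_le_reg_r a); [easy|]. unfold Rdiv at 1. rewrite Rmult_assoc, Rinv_l by lra. lra. }
  assert (Hpos : 0 < b / a) by (apply Rmult_lt_0_compat; lra).
  specialize (H (b / a) ltac:(lra) (/ a *v x) (/ b *v y)).
  rewrite !norm_scal in H by lra. fold a b in H.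
  specialize (H ltac:(field; lra) ltac:(field; lra)).
  replace (/ a *v x +v b / a *v (/ b *v y)) with (/ a *v (x +v y)) in H by vec.
  replace (/ a *v x -v b / a *v (/ b *v y)) with (/ a *v (x -v y)) in H by vec.
  rewrite !norm_scal in H by lra.
  assert (H' : ((/ a * ⟦x +v y⟧ + / a * ⟦x -v y⟧) / 2 - 1) * (2 * a) <= eps / 2 * (b / a) * (2 * a))
    by (apply Rmult_le_compat_r; lra).
  replace (((/ a * ⟦x +v y⟧ + / a * ⟦x -v y⟧) / 2 - 1) * (2 * a))
    with (⟦x +v y⟧ + ⟦x -v y⟧ - 2 * a) in H' by (field; lra).
  replace (eps / 2 * (b / a) * (2 * a)) with (eps * b) in H' by (field; lra). lra.
Qed.

End Norm.

(** * Nested sequences of convex sets *)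

Lemma infimum (P : R -> Prop) :
  (exists r, P r) -> (forall r, P r -> 0 <= r) ->
  exists d, 0 <= d /\ (forall r, P r -> d <= r) /\
    forall eta, eta > 0 -> exists r, P r /\ r < d + eta.
Proof.
  intros [r0 Hr0] Hpos.
  destruct (completeness (fun x => P (- x))) as [m [Hub Hlub]].
  - exists 0. intros x Hx. apply Hpos in Hx. lra.
  - exists (- r0). now rewrite Ropp_involutive.
  - exists (- m). split; [|split].
    + apply Ropp_0_ge_le_contravar, Rle_ge, Hlub. intros x Hx. apply Hpos in Hx. lra.
    + intros r Hr. assert (- r <= m) by (apply Hub; now rewrite Ropp_involutive). lra.
    + intros eta He. apply NNPP. intro Hn.
      assert (m <= m - eta); [|lra].
      apply Hlub. intros x Hx. apply Rnot_lt_le. intro Hlt.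
      apply Hn. exists (- x). split; [easy|lra].
Qed.

Lemma nested_le {A : Type} (C : nat -> A -> Prop) :
  (forall n z, C (S n) z -> C n z) -> forall n m z, (n <= m)%nat -> C m z -> C n z.
Proof. intros H n m z Hnm. induction Hnm; auto. Qed.

Lemma inv_INR_lt eps : eps > 0 -> exists n, / INR (S n) < eps.
Proof.
  intro He. destruct (archimed_cor1 eps He) as [n [Hn Hn0]]. exists n.
  eapply Rle_lt_trans; [|exact Hn]. apply Rinv_le_contravar.
  - now apply lt_0_INR.
  - apply le_INR. lia.
Qed.

Lemma inv_INR_pos n : 0 < / INR (S n).
Proof. apply Rinv_0_lt_compat, lt_0_INR. lia. Qed.

Lemma inv_INR_le n m : (n <= m)%nat -> / INR (S m) <= / INR (S n).
Proof. intro H. apply Rinv_le_contravar; [apply lt_0_INR|apply le_INR]; lia. Qed.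

Section Nested.
Context {E : NormedSpace} (Hus : uniformly_smooth E).

(* If the infimum [d] of the radii of balls meeting every [C n] were positive,
   almost optimal points [x1], [x2] around an almost optimal centre would satisfy
   [|x2 + t x1| >= (1 + t) d] and [|x2 - t x1| >= d] up to small errors, although
   [|x1|], [|x2|] are at most about [d]: this contradicts smoothness for small [t]. *)
Lemma nested_almost_center (C : nat -> E -> Prop) (e0 : E) (M : R) :
  (forall n, exists z, C n z) -> (forall n z, C (S n) z -> C n z) ->
  (forall n, ns_convex_set (C n)) -> (forall z, C 0%nat z -> ⟦z -v e0⟧ <= M) ->
  forall eps, eps > 0 -> exists e, forall n, exists c, C n c /\ ⟦c -v e⟧ <= eps.
Proof.
  intros Hne Hdec Hcv Hb eps Heps.
  set (P := fun r => exists e, forall n, exists c, C n c /\ ⟦c -v e⟧ <= r).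
  destruct (infimum P) as [d [Hd0 [Hlow Happ]]].
  { exists M, e0. intro n. destruct (Hne n) as [z Hz]. exists z. split; [easy|].
    apply Hb, (nested_le C Hdec 0 n); [lia|easy]. }
  { intros r [e He]. destruct (He 0%nat) as [c [_ Hc]].
    assert (H := ns_norm_ge0 E (c -v e)). lra. }
  destruct (Rle_lt_dec d 0) as [Hd|Hd].
  { destruct (Happ eps Heps) as [r [[e He] Hr]]. exists e. intro n.
    destruct (He n) as [c [Hc Hce]]. exists c. split; [easy|lra]. }
  exfalso.
  destruct (smooth_le Hus (1/2) ltac:(lra)) as [del [Hdel Hsm]].
  (* Below, |x1 - e| <= 2 |x2 - e|, so [del / 2] makes t (x1 - e) short enough for [Hsm]. The errors
     of size [eta * d] stay below the gain t d / 2 that smoothness with constant 1/2 leaves. *)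
  set (t := Rmin 1 (del / 2)).
  assert (Ht : 0 < t <= 1 /\ t <= del / 2).
  { unfold t. assert (A := Rmin_l 1 (del / 2)). assert (B := Rmin_r 1 (del / 2)).
    assert (0 < Rmin 1 (del / 2)) by (apply Rmin_glb_lt; lra). lra. }
  destruct Ht as [[Ht0 Ht1] Htd]. clearbody t.
  set (eta := t / 16).
  destruct (Happ (eta * d)) as [r [[e He] Hr]]; [unfold eta; nra|].
  assert (Hfar : forall z, exists n, forall c, C n c -> (1 - eta) * d < ⟦c -v z⟧).
  { intro z. apply NNPP. intro Hn.
    assert (Hlt : P ((1 - eta) * d)).
    { exists z. intro n. apply NNPP. intro Hn'. apply Hn. exists n. intros c Hc.
      apply Rnot_le_lt. intro Hle. apply Hn'. now exists c. }
    apply Hlow in Hlt. unfold eta in Hlt. nra. }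
  destruct (Hfar e) as [n1 Hn1].
  destruct (He n1) as [x1 [Hx1 Hx1r]].
  destruct (Hfar (e +v t *v (x1 -v e))) as [n2 Hn2].
  set (n := Nat.max n1 n2).
  destruct (He n) as [x2 [Hx2 Hx2r]].
  assert (H1 : C n1 x2) by (apply (nested_le C Hdec n1 n); [lia|easy]).
  assert (H2 : C n2 x2) by (apply (nested_le C Hdec n2 n); [lia|easy]).
  (* Convexity keeps this weighted mean in [C n1]; its difference from e is (x2 - e) + t (x1 - e)
     divided by 1 + t, so [Hn1] bounds that sum from below. *)
  assert (Hmid : C n1 (/ (1 + t) *v x2 +v (1 - / (1 + t)) *v x1)).
  { apply Hcv; try easy. split; [left; apply Rinv_0_lt_compat; lra|].
    rewrite <- Rinv_1. apply Rinv_le_contravar; lra. }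
  apply Hn1 in Hmid.
  replace (/ (1 + t) *v x2 +v (1 - / (1 + t)) *v x1 -v e)
    with (/ (1 + t) *v ((x2 -v e) +v t *v (x1 -v e))) in Hmid by vec.
  assert (Hit : 0 < / (1 + t)) by (apply Rinv_0_lt_compat; lra).
  rewrite norm_scal in Hmid by lra.
  assert (Hplus : (1 + t) * ((1 - eta) * d) < ⟦(x2 -v e) +v t *v (x1 -v e)⟧).
  { apply (Rmult_lt_compat_l (1 + t)) in Hmid; [|lra].
    rewrite <- (Rmult_assoc _ (/ (1 + t))), Rinv_r, Rmult_1_l in Hmid by lra. exact Hmid. }
  assert (Hminus := Hn2 x2 H2).
  replace (x2 -v (e +v t *v (x1 -v e))) with ((x2 -v e) -v t *v (x1 -v e)) in Hminus by vec.
  assert (Hx2l := Hn1 x2 H1).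
  specialize (Hsm (x2 -v e) (t *v (x1 -v e))).
  rewrite norm_scal in Hsm by lra.
  set (a := ⟦x2 -v e⟧) in *. set (b := ⟦x1 -v e⟧) in *.
  assert (Hsmall : t * b <= del * a).
  { assert (b <= 2 * a) by (unfold eta in *; nra).
    assert (0 <= b) by apply ns_norm_ge0. nra. }
  specialize (Hsm Hsmall). unfold eta in *.
  assert (t * b <= t * ((1 + t / 16) * d)) by (apply Rmult_le_compat_l; lra).
  assert (0 < t * d) by nra. assert (t * t * d <= t * d) by nra. nra.
Qed.

(** Stage k + 1 cuts the family down to a ball of radius 1/(k + 1). The centre depends on the
    previous stage, hence the choice by [epsilon] inside the recursion; it does not depend on [n],
    so one ball serves the whole family. *)
Fixpoint shrink (C : nat -> E -> Prop) (k : nat) : nat -> E -> Prop :=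
  match k with
  | O => C
  | S k =>
      let D := shrink C k in
      let e := epsilon (inhabits ns_zero) (fun e =>
        forall n, exists c, D n c /\ ⟦c -v e⟧ <= / INR (S k)) in
      fun n z => D n z /\ ⟦z -v e⟧ <= / INR (S k)
  end.

(** A Cantor argument: almost centres exist at every stage, so [shrink] never becomes empty; a
    diagonal selection is Cauchy because its late terms share a small ball, and its limit lies in
    every closed [C n]. *)
Lemma nested_inter (HE : complete E) (C : nat -> E -> Prop) (e0 : E) (M : R) :
  (forall n, exists z, C n z) -> (forall n z, C (S n) z -> C n z) ->
  (forall n, ns_convex_set (C n)) -> (forall n, ns_closed_set (C n)) ->
  (forall z, C 0%nat z -> ⟦z -v e0⟧ <= M) ->
  exists z, forall n, C n z.
Proof.
  intros Hne Hdec Hcv Hcl Hb.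
  assert (Hinv : forall k, (forall n, exists z, shrink C k n z) /\
     (forall n z, shrink C k (S n) z -> shrink C k n z) /\
     (forall n, ns_convex_set (shrink C k n)) /\ (forall n z, shrink C k n z -> C n z)).
  { induction k as [|k [IHne [IHdec [IHcv IHC]]]]; [easy|].
    simpl shrink. set (e := epsilon _ _).
    assert (He : forall n, exists c, shrink C k n c /\ ⟦c -v e⟧ <= / INR (S k)).
    { unfold e. apply epsilon_spec.
      apply (nested_almost_center (shrink C k) e0 M); auto. apply inv_INR_pos. }
    clearbody e. split; [exact He|split; [|split]].
    - intros n z [H1 H2]. auto.
    - intro n. apply convex_and; [auto|apply ball_convex].
    - intros n z [H1 _]. auto. }
  assert (Hsk : forall j k n z, (j <= k)%nat -> shrink C k n z -> shrink C j n z).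
  { intros j k n z Hjk. induction Hjk; [easy|]. intros [H _]. auto. }
  destruct (choice (fun k z => shrink C (S k) k z)) as [c Hc].
  { intro k. apply Hinv. }
  assert (Hcc : seq_cauchy c).
  { intros eps Heps. destruct (inv_INR_lt (eps / 2)) as [K HK]; [lra|].
    exists K. intros n m Hn Hm.
    assert (Hn' := Hsk (S K) (S n) n _ ltac:(lia) (Hc n)).
    assert (Hm' := Hsk (S K) (S m) m _ ltac:(lia) (Hc m)).
    destruct Hn' as [_ Hn'], Hm' as [_ Hm'].
    set (e := epsilon _ _) in *.
    assert (A := norm_sub_trans e (c n) (c m)). rewrite (norm_sub_comm e) in A. lra. }
  destruct (HE c Hcc) as [l Hl]. exists l. intro n.
  apply (Hcl n (fun k => c (k + n)%nat)).
  - intro k. apply (nested_le C Hdec n (k + n)%nat); [lia|].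
    apply (proj2 (proj2 (proj2 (Hinv (S (k + n)))))), Hc.
  - intros eps Heps. destruct (Hl eps Heps) as [N HN]. exists N. intros k Hk. apply HN. lia.
Qed.

End Nested.

(** * Normal structure and fixed points *)

Section FixedPoint.
Context {E : NormedSpace} (HE : complete E) (Hus : uniformly_smooth E).

(* If no [z] works, choose [y k] almost at distance [d] from the averages [zs k],
   where [zs (k+1)] is the midpoint of [zs k] and [y k].  Then [y k] is almost at
   distance [d] from every fixed point of the closed convex hull of the sequence,
   in particular from a point [e] common to the closed convex hulls of all tails.
   For [v = y N - y k] and [a = y N - e] this forces [|v - t a| >= d] and
   [|v + t a| >= (1 + t) d] up to small errors, contradicting smoothness. *)
Lemma normal_structure (K : E -> Prop) (d : R) :
  (exists z, K z) -> ns_closed_set K -> ns_convex_set K -> 0 < d ->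
  (forall x y, K x -> K y -> ⟦x -v y⟧ <= d) ->
  exists z r, K z /\ r < d /\ forall y, K y -> ⟦y -v z⟧ <= r.
Proof.
  intros [z0 Hz0] Hcl Hcv Hd Hdiam. apply NNPP. intro Hn.
  assert (Hfar : forall z eta, K z -> eta > 0 -> exists y, K y /\ d - eta < ⟦y -v z⟧).
  { intros z eta Hz Heta. apply NNPP. intro Hn'. apply Hn. exists z, (d - eta).
    split; [easy|split; [lra|]]. intros y Hy. apply Rnot_lt_le. intro. apply Hn'. now exists y. }
  clear Hn.
  assert (Hlam : forall k, 0 < (/ 2) ^ k <= 1).
  { induction k; simpl; lra. }
  (* The factor (1/2)^k in the tolerance compensates for the weight (1/2)^k by which [HWfar]
     divides. *)
  destruct (choice (fun (p : E * nat) y => K (fst p) ->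
     K y /\ d - (/ 2) ^ (snd p) * / INR (S (snd p)) < ⟦y -v fst p⟧)) as [F HF].
  { intros [z k]. destruct (classic (K z)) as [Hz|Hz]; [|now exists z0].
    destruct (Hfar z ((/ 2) ^ k * / INR (S k)) Hz) as [y Hy]; [|now exists y].
    apply Rmult_lt_0_compat; [apply Hlam|apply inv_INR_pos]. }
  pose (zs := fix zs k := match k with
     | O => z0 | S k => / 2 *v zs k +v (1 - / 2) *v F (zs k, k) end).
  assert (HzsS : forall k, zs (S k) = / 2 *v zs k +v (1 - / 2) *v F (zs k, k)) by easy.
  pose (y := fun k => F (zs k, k)).
  assert (HzsK : forall k, K (zs k)).
  { induction k as [|k IH]; [easy|]. rewrite HzsS. apply Hcv; [easy|apply (HF (zs k, k) IH)|lra]. }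
  assert (HyK : forall k, K (y k)) by (intro k; apply (HF (zs k, k)), HzsK).
  assert (Hyfar : forall k, d - (/ 2) ^ k * / INR (S k) < ⟦y k -v zs k⟧)
    by (intro k; apply (HF (zs k, k)), HzsK).
  change (forall k, zs (S k) = / 2 *v zs k +v (1 - / 2) *v y k) in HzsS.
  clearbody y. clearbody zs.
  (* [W k] collects the points of K that occur with weight (1/2)^k in a convex representation of
     [zs k]. Being almost at distance d from [zs k], [y k] must be almost at distance d from each of
     them, as no point of K is farther away. *)
  pose (W := fun k w => K w /\ exists w', K w' /\
     zs k = (/ 2) ^ k *v w +v (1 - (/ 2) ^ k) *v w').
  assert (Hhalf : forall l, 0 < l <= 1 -> forall w' y', K w' -> K y' ->
     forall m, 0 <= m <= 1 - l / 2 -> exists w'', K w'' /\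
       (1 - l / 2) *v w'' = m *v w' +v (1 - l / 2 - m) *v y').
  { intros l Hl w' y' Hw' Hy' m Hm. exists (m / (1 - l / 2) *v w' +v (1 - m / (1 - l / 2)) *v y').
    split; [|vec]. apply Hcv; try easy. assert (0 < / (1 - l / 2)) by (apply Rinv_0_lt_compat; lra).
    split; [apply Rmult_le_pos; lra|].
    apply (Rmult_le_reg_r (1 - l / 2)); [lra|]. unfold Rdiv at 1.
    rewrite Rmult_assoc, Rinv_l by lra. lra. }
  assert (HWS : forall k w, W k w -> W (S k) w).
  { intros k w [Hw [w' [Hw' Heq]]]. split; [easy|].
    destruct (Hhalf _ (Hlam k) w' (y k) Hw' (HyK k) (/ 2 * (1 - (/ 2) ^ k))) as [w'' [HK Heq']].
    { specialize (Hlam k). lra. }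
    exists w''. split; [easy|]. rewrite HzsS, Heq. simpl pow. set (l := (/ 2) ^ k) in *.
    replace (1 - / 2 * l) with (1 - l / 2) by field. rewrite Heq'. vec. }
  assert (HWle : forall j k w, (j <= k)%nat -> W j w -> W k w).
  { intros j k w Hjk. induction Hjk; auto. }
  assert (HWy : forall k, W (S k) (y k)).
  { intro k. split; [easy|].
    destruct (Hhalf _ (Hlam k) (zs k) (y k) (HzsK k) (HyK k) (/ 2)) as [w'' [HK Heq']].
    { specialize (Hlam k). lra. }
    exists w''. split; [easy|]. rewrite HzsS. simpl pow. set (l := (/ 2) ^ k) in *.
    replace (1 - / 2 * l) with (1 - l / 2) by field. rewrite Heq'. vec. }
  assert (HWcv : forall k, ns_convex_set (W k)).
  { intros k w1 w2 t [Hw1 [w1' [Hw1' E1]]] [Hw2 [w2' [Hw2' E2]]] Ht.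
    split; [now apply Hcv|]. exists (t *v w1' +v (1 - t) *v w2'). split; [now apply Hcv|].
    replace (zs k) with (t *v zs k +v (1 - t) *v zs k) by vec.
    rewrite E1 at 1. rewrite E2. vec. }
  assert (HWfar : forall k w, W k w -> d - / INR (S k) < ⟦y k -v w⟧).
  { intros k w [Hw [w' [Hw' Heq]]]. specialize (Hyfar k). specialize (Hlam k).
    set (l := (/ 2) ^ k) in *.
    assert (A := norm_comb (y k -v zs k) (y k -v w) (y k -v w') l (1 - l)
                   ltac:(lra) ltac:(lra) ltac:(rewrite Heq; vec)).
    assert (B := Hdiam _ _ (HyK k) Hw').
    apply (Rmult_lt_reg_l l); [easy|]. nra. }
  (* The closure of the union of the increasing sets [W k]: closed, convex and containing every
     [y k]. *)
  pose (V := fun e => forall eps, eps > 0 -> exists k w, W k w /\ ⟦e -v w⟧ < eps).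
  assert (HVy : forall k, V (y k)).
  { intros k eps Heps. exists (S k), (y k). split; [easy|].
    replace (y k -v y k) with (@ns_zero E) by vec. rewrite norm_zero. lra. }
  assert (HVcv : ns_convex_set V).
  { intros e1 e2 t H1 H2 Ht eps Heps.
    destruct (H1 eps Heps) as [k1 [w1 [Hw1 D1]]]. destruct (H2 eps Heps) as [k2 [w2 [Hw2 D2]]].
    exists (Nat.max k1 k2), (t *v w1 +v (1 - t) *v w2). split.
    - apply HWcv; try easy; [apply (HWle k1)|apply (HWle k2)]; try easy; lia.
    - assert (A := norm_comb (t *v e1 +v (1 - t) *v e2 -v (t *v w1 +v (1 - t) *v w2))
                     (e1 -v w1) (e2 -v w2) t (1 - t) ltac:(lra) ltac:(lra) ltac:(vec)).
      assert (B := Rmax_lub_lt _ _ _ D1 D2).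
      assert (B1 := Rmult_le_compat_l t _ _ (proj1 Ht) (Rmax_l (⟦e1 -v w1⟧) (⟦e2 -v w2⟧))).
      assert (B2 := Rmult_le_compat_l (1 - t) _ _ ltac:(lra) (Rmax_r (⟦e1 -v w1⟧) (⟦e2 -v w2⟧))).
      lra. }
  assert (HVcl : ns_closed_set V).
  { intros s l Hs Hl eps Heps. destruct (Hl (eps / 2) ltac:(lra)) as [N HN].
    specialize (HN N (le_n N)). destruct (Hs N (eps / 2) ltac:(lra)) as [k [w [Hw D]]].
    exists k, w. split; [easy|]. rewrite norm_sub_comm in HN.
    assert (A := norm_sub_trans (s N) l w). lra. }
  assert (HVfar : forall e, V e -> forall eta, eta > 0 ->
     exists N, forall k, (N <= k)%nat -> d - eta < ⟦y k -v e⟧).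
  { intros e He eta Heta. destruct (He (eta / 2) ltac:(lra)) as [j [w [Hw D]]].
    destruct (inv_INR_lt (eta / 2) ltac:(lra)) as [n Hn].
    exists (Nat.max j n). intros k Hk.
    assert (A := HWfar k w (HWle j k w ltac:(lia) Hw)).
    assert (B := norm_sub_trans e (y k) w). assert (I := inv_INR_le n k ltac:(lia)). lra. }
  clear HWS HWle HWy HWcv HWfar Hhalf HzsS HzsK Hyfar HF Hfar Hlam. clearbody V. clear W.
  (* The closed convex hull of the tail from [n] on, as the intersection of all closed convex sets
     containing it. *)
  destruct (nested_inter Hus HE (fun n z => forall A : E -> Prop, ns_closed_set A ->
     ns_convex_set A -> (forall k, (n <= k)%nat -> A (y k)) -> A z) (y 0%nat) d) as [e He].
  - intro n. exists (y n). intros A _ _ H. apply H. lia.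
  - intros n z Hz A Acl Acv H. apply Hz; try easy. intros k Hk. apply H. lia.
  - intros n z1 z2 t H1 H2 Ht A Acl Acv H. apply Acv; [apply H1|apply H2|]; easy.
  - intros n s l Hs Hl A Acl Acv H. apply (Acl s); auto. intro k. apply Hs; auto.
  - intros z Hz. apply (Hz (fun z => ⟦z -v y 0%nat⟧ <= d));
      [apply ball_closed|apply ball_convex|]. auto.
  - assert (HeK : K e) by (apply (He 0%nat); auto).
    assert (HeV : V e) by (apply (He 0%nat); auto).
    destruct (smooth_le Hus (1/2) ltac:(lra)) as [del [Hdel Hsm]].
    (* Since |v| >= d/4 will hold, [del / 4] gives t |a| <= del |v|, as smoothness requires. *)
    set (t := Rmin (1/2) (del / 4)).
    assert (Ht : 0 < t <= 1/2 /\ t <= del / 4).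
    { unfold t. assert (A := Rmin_l (1/2) (del / 4)). assert (B := Rmin_r (1/2) (del / 4)).
      assert (0 < Rmin (1/2) (del / 4)) by (apply Rmin_glb_lt; lra). lra. }
    destruct Ht as [[Ht0 Ht1] Htd]. clearbody t.
    set (eta := t * d / 8). assert (Heta : eta > 0) by (unfold eta; nra).
    destruct (HVfar e HeV eta Heta) as [N HN]. specialize (HN N (le_n N)).
    set (w := t *v e +v (1 - t) *v y N).
    assert (HwV : V w) by (apply HVcv; auto; lra).
    destruct (HVfar w HwV eta Heta) as [N2 HN2].
    (* The centre lies at distance (1 + t) |y N - e| from e, so the ball of this smaller radius
       misses e. As e is in the hull of the tail from [N2], the ball also misses some [y k] of that
       tail. *)
    assert (Hex : exists k, (N2 <= k)%nat /\
       (1 + t) * (d - eta) - eta < ⟦y k -v ((1 + t) *v y N -v t *v e)⟧).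
    { apply NNPP. intro Hn.
      assert (Hball := He N2 (fun z => ⟦z -v ((1 + t) *v y N -v t *v e)⟧ <= (1 + t) * (d - eta) - eta)
        (ball_closed _ _) (ball_convex _ _)).
      simpl in Hball.
      replace (e -v ((1 + t) *v y N -v t *v e)) with ((1 + t) *v (e -v y N)) in Hball by vec.
      rewrite norm_scal, norm_sub_comm in Hball by lra.
      enough ((1 + t) * ⟦y N -v e⟧ <= (1 + t) * (d - eta) - eta) by nra.
      apply Hball. intros k Hk. apply Rnot_lt_le. intro. apply Hn. now exists k. }
    destruct Hex as [k [Hk Hplus]]. specialize (HN2 k Hk).
    rewrite norm_sub_comm in HN2, Hplus.
    replace (w -v y k) with ((y N -v y k) -v t *v (y N -v e)) in HN2 by (unfold w; vec).
    replace ((1 + t) *v y N -v t *v e -v y k) with ((y N -v y k) +v t *v (y N -v e)) in Hplus by vec.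
    specialize (Hsm (y N -v y k) (t *v (y N -v e))).
    assert (Hv := Hdiam _ _ (HyK N) (HyK k)). assert (Ha := Hdiam _ _ (HyK N) HeK).
    assert (A := norm_comb ((y N -v y k) -v t *v (y N -v e)) (y N -v y k) (e -v y N) 1 t
                  ltac:(lra) ltac:(lra) ltac:(vec)).
    rewrite (norm_sub_comm e) in A.
    rewrite norm_scal in Hsm by lra.
    set (a := ⟦y N -v e⟧) in *. set (v := ⟦y N -v y k⟧) in *.
    assert (t * a <= t * d) by (apply Rmult_le_compat_l; lra).
    assert (t * d <= / 2 * d) by (apply Rmult_le_compat_r; lra).
    assert (d / 4 <= v) by (unfold eta in *; lra).
    assert (t * a <= del * v).
    { apply Rle_trans with (t * d); [easy|]. apply Rle_trans with (del / 4 * d); nra. }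
    specialize (Hsm ltac:(easy)).
    assert (t * eta <= / 2 * eta) by (apply Rmult_le_compat_r; lra).
    unfold eta in *. lra.
Qed.

Definition invariant_set (T : E -> E) (C : E -> Prop) : Prop :=
  (exists z, C z) /\ ns_closed_set C /\ ns_convex_set C /\ (forall x, C x -> C (T x)).

(* Gillespie and Williams: the smallest invariant subset containing [z] lies in
   the ball of radius [r] around each of its points, because the centres of
   balls of radius [r] containing it form an invariant set. *)
Lemma invariant_subset_small (T : E -> E) (C : E -> Prop) (z : E) (r : R) :
  invariant_set T C -> nonexpansive_on C T -> C z -> (forall y, C y -> ⟦y -v z⟧ <= r) ->
  exists M, invariant_set T M /\ (forall x, M x -> C x) /\
    forall x y, M x -> M y -> ⟦x -v y⟧ <= r.
Proof.
  intros HC Hne Hz Hr.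
  pose (M := fun w => forall A, invariant_set T A -> A z -> A w).
  assert (HMcl : ns_closed_set M).
  { intros s l Hs Hl A HA Hz'. apply (proj1 (proj2 HA) s); [intro n; now apply Hs|easy]. }
  assert (HMcv : ns_convex_set M).
  { intros x y t Hx Hy Ht A HA Hz'. destruct HA as [A1 [A2 [A3 A4]]]. apply A3; [apply Hx|apply Hy|]; easy. }
  assert (HMT : forall x, M x -> M (T x)).
  { intros x Hx A HA Hz'. destruct HA as [A1 [A2 [A3 A4]]]. apply A4, Hx; easy. }
  assert (HMz : M z) by (intros A _ H; exact H).
  assert (HMC : forall x, M x -> C x) by (intros x Hx; apply Hx; auto).
  exists M. split; [split; [now exists z|easy]|split; [easy|]].
  assert (HA : forall y, M y -> M y /\ forall m, M m -> ⟦y -v m⟧ <= r).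
  { intros y Hy. apply Hy; clear y Hy.
    - split; [|split; [|split]].
      + exists z. split; [easy|]. intros m Hm. rewrite norm_sub_comm. auto.
      + intros s l Hs Hl. split; [apply (HMcl s); [apply Hs|easy]|].
        intros m Hm. apply (ball_closed m r s); [intro n; now apply Hs|easy].
      + intros x y t [Hx Hx'] [Hy Hy'] Ht. split; [now apply HMcv|].
        intros m Hm. apply ball_convex; auto.
      + intros y [Hy Hy']. split; [auto|]. intros m Hm. rewrite norm_sub_comm.
        (* Minimality of M is used a second time: the points of M within r of T y form an invariant
           set, because y is within r of all of M and T is nonexpansive. *)
        enough (M m /\ ⟦m -v T y⟧ <= r) by easy.
        apply Hm; clear m Hm.
        * split; [|split; [|split]].
          -- exists z. split; [easy|]. rewrite norm_sub_comm. auto.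
          -- apply closed_and; [easy|apply ball_closed].
          -- apply convex_and; [easy|apply ball_convex].
          -- intros m [Hm Hm']. split; [auto|]. rewrite norm_sub_comm.
             eapply Rle_trans; [apply Hne|]; auto.
        * split; [easy|]. rewrite norm_sub_comm. auto.
    - split; [easy|]. intros m Hm. rewrite norm_sub_comm. auto. }
  intros x y Hx Hy. now apply HA.
Qed.

(* A decreasing sequence of invariant sets, each of almost minimal diameter
   among the invariant subsets of the previous one, has an intersection whose
   invariant subsets all have the same diameter; by normal structure it is a point. *)
Theorem nonexpansive_fixed_point (K : E -> Prop) (T : E -> E) (d0 : R) :
  invariant_set T K -> nonexpansive_on K T ->
  (forall x y, K x -> K y -> ⟦x -v y⟧ <= d0) -> exists p, fixed_point K T p.
Proof.
  intros HK Hne Hd0.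
  pose (bnd := fun (C : E -> Prop) d => forall x y, C x -> C y -> ⟦x -v y⟧ <= d).
  destruct (choice (fun (p : (E -> Prop) * nat) (C' : E -> Prop) =>
     let C := fst p in invariant_set T C -> (forall x, C x -> K x) ->
     invariant_set T C' /\ (forall x, C' x -> C x) /\
     forall B d, invariant_set T B -> (forall x, B x -> C x) -> bnd B d ->
       bnd C' (d + / INR (S (snd p))))) as [next Hnext].
  { intros [C n]. cbv zeta. simpl fst; simpl snd. destruct (classic (invariant_set T C /\ forall x, C x -> K x))
      as [[HC HCK]|Hno]; [|exists C; intros; now destruct Hno].
    destruct (infimum (fun d => exists B, invariant_set T B /\ (forall x, B x -> C x) /\ bnd B d))
      as [m [_ [Hlow Happ]]].
    - exists d0, C. split; [easy|split; [easy|]]. intros x y Hx Hy. auto.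
    - intros d [B [[[z Hz] _] [_ HB]]]. eapply Rle_trans; [apply ns_norm_ge0|apply (HB z z Hz Hz)].
    - destruct (Happ _ (inv_INR_pos n)) as [d [[B [HB [HBC Hd]]] Hlt]].
      exists B. intros _ _. split; [easy|split; [easy|]].
      intros B' d' HB' HBC' Hd' x y Hx Hy.
      assert (m <= d') by (apply Hlow; now exists B').
      assert (A := Hd x y Hx Hy). lra. }
  pose (C := fix C n := match n with O => K | S n => next (C n, n) end).
  assert (HCinv : forall n, invariant_set T (C n) /\ (forall x, C n x -> K x)).
  { induction n as [|n [IH1 IH2]]; [easy|]. simpl.
    destruct (Hnext (C n, n) IH1 IH2) as [H1 [H2 _]]. simpl in *. auto. }
  assert (HCS : forall n, (forall x, C (S n) x -> C n x) /\
     forall B d, invariant_set T B -> (forall x, B x -> C n x) -> bnd B d ->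
       bnd (C (S n)) (d + / INR (S n))).
  { intro n. destruct (HCinv n) as [H1 H2]. destruct (Hnext (C n, n) H1 H2) as [_ H]. exact H. }
  change K with (C 0%nat) in Hd0. change (nonexpansive_on (C 0%nat) T) in Hne.
  clearbody C.
  pose (D := fun z => forall n, C n z).
  assert (HDK : forall x, D x -> K x) by (intros x Hx; apply (HCinv 0%nat), Hx).
  assert (HD : invariant_set T D).
  { split; [|split; [|split]].
    - destruct (proj1 (proj1 (HCinv 0%nat))) as [z Hz].
      apply (nested_inter Hus HE C z d0); try (intro n; apply HCinv).
      + intros n. apply HCS.
      + intros x Hx. now apply Hd0.
    - intros s l Hs Hl n. apply (proj1 (proj2 (proj1 (HCinv n))) s); [intro k; apply Hs|easy].
    - intros x y t Hx Hy Ht n. destruct (HCinv n) as [[_ [_ [Hcv _]]] _]. now apply Hcv.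
    - intros x Hx n. destruct (HCinv n) as [[_ [_ [_ HCT]]] _]. apply HCT, Hx. }
  assert (Hconst : forall B d, invariant_set T B -> (forall x, B x -> D x) -> bnd B d -> bnd D d).
  { intros B d HB HBD Hd x y Hx Hy. apply Rnot_lt_le. intro Hlt.
    destruct (inv_INR_lt (⟦x -v y⟧ - d) ltac:(lra)) as [n Hn].
    assert (A := proj2 (HCS n) B d HB (fun x Hx => HBD x Hx n) Hd x y (Hx (S n)) (Hy (S n))). lra. }
  destruct (completeness (fun s => exists x y, D x /\ D y /\ s = ⟦x -v y⟧)) as [d [Hub Hlub]].
  { exists d0. intros s [x [y [Hx [Hy ->]]]]. apply Hd0; auto. }
  { destruct HD as [[z Hz] _]. exists (⟦z -v z⟧), z, z. easy. }
  assert (Hbnd : bnd D d).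
  { intros x y Hx Hy. apply Hub. now exists x, y. }
  destruct (Rle_lt_dec d 0) as [Hd|Hd].
  - destruct HD as [[p Hp] [_ [_ HDT]]]. exists p. split; [auto|]. apply sub_norm0.
    assert (A := Hbnd (T p) p (HDT p Hp) Hp). lra.
  - exfalso. destruct (normal_structure D d) as [z [r [Hz [Hr Hzr]]]]; try easy; try apply HD.
    (* The ball of radius r < d around z contains [D], so some invariant subset has diameter at most
       r; by [Hconst] the same bound then holds for [D], whose diameter is d. *)
    destruct (invariant_subset_small T D z r) as [M [HM [HMD HMr]]]; try easy.
    { intros x y Hx Hy. apply Hne; auto. }
    assert (A := Hconst M r HM HMD HMr).
    apply (Rlt_irrefl d). apply Rle_lt_trans with r; [|easy].
    apply Hlub. intros s [x [y [Hx [Hy ->]]]]. auto.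
Qed.

End FixedPoint.

(** * Convergence of the approximating path *)

Section Path.
Context {E : NormedSpace} (HE : complete E) (Hus : uniformly_smooth E).
Context (D : E -> Prop) (HDcl : ns_closed_set D) (HDcv : ns_convex_set D).
Context (T : E -> E) (HTD : forall x, D x -> D (T x)) (HTne : nonexpansive_on D T).
Context (u : E) (Hu : D u) (xt : R -> E).
Context (Hxt : forall t, 0 < t < 1 ->
           D (xt t) /\ xt t = t *v u +v (1 - t) *v T (xt t)).

Lemma path_sub t z : 0 < t < 1 ->
  xt t -v z = t *v (u -v z) +v (1 - t) *v (T (xt t) -v z).
Proof.
  intro Ht. destruct (Hxt t Ht) as [_ Heq]. rewrite Heq at 1. vec.
Qed.

Lemma path_bounded p t : fixed_point D T p -> 0 < t < 1 -> ⟦xt t -v p⟧ <= ⟦u -v p⟧.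
Proof.
  intros [Hp HTp] Ht. destruct (Hxt t Ht) as [HD _].
  assert (A := norm_comb _ _ _ t (1 - t) ltac:(lra) ltac:(lra) (path_sub t p Ht)).
  assert (B := HTne _ _ HD Hp). rewrite HTp in B.
  apply (Rmult_le_compat_l (1 - t)) in B; [|lra]. apply (Rmult_le_reg_l t); lra.
Qed.

Lemma path_almost_fixed p t : fixed_point D T p -> 0 < t < 1 ->
  ⟦T (xt t) -v xt t⟧ <= t * (2 * ⟦u -v p⟧).
Proof.
  intros Hfix Ht. assert (B := path_bounded p t Hfix Ht).
  destruct Hfix as [Hp HTp]. destruct (Hxt t Ht) as [HD _].
  assert (C := HTne _ _ HD Hp). rewrite HTp in C.
  rewrite norm_sub_comm, (path_sub t (T (xt t)) Ht).
  replace (t *v (u -v T (xt t)) +v (1 - t) *v (T (xt t) -v T (xt t)))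
    with (t *v (u -v T (xt t))) by vec.
  rewrite norm_scal by lra. apply Rmult_le_compat_l; [lra|].
  assert (A := norm_sub_trans p u (T (xt t))). rewrite (norm_sub_comm p) in A. lra.
Qed.

(* [limsup_le r z]: the upper limit of [|xt t - z|] as [t -> 0+] is at most [r]. *)
Definition limsup_le (r : R) (z : E) : Prop :=
  D z /\ forall r', r < r' -> exists d, d > 0 /\ forall t, 0 < t < d -> ⟦xt t -v z⟧ <= r'.

Lemma limsup_le_closed r : ns_closed_set (limsup_le r).
Proof.
  intros s l Hs Hl. split; [apply (HDcl s); [apply Hs|easy]|]. intros r' Hr'.
  destruct (Hl ((r' - r) / 2) ltac:(lra)) as [N HN]. specialize (HN N (le_n N)).
  destruct (proj2 (Hs N) ((r + r') / 2) ltac:(lra)) as [d [Hd H]]. exists d. split; [easy|].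
  intros t Ht. specialize (H t Ht). assert (A := norm_sub_trans (s N) (xt t) l). lra.
Qed.

Lemma limsup_le_convex r : ns_convex_set (limsup_le r).
Proof.
  intros x y s [Hx Hx'] [Hy Hy'] Hs. split; [now apply HDcv|]. intros r' Hr'.
  destruct (Hx' r' Hr') as [d1 [Hd1 H1]]. destruct (Hy' r' Hr') as [d2 [Hd2 H2]].
  exists (Rmin d1 d2). split; [now apply Rmin_glb_lt|]. intros t Ht.
  assert (A := Rmin_l d1 d2). assert (B := Rmin_r d1 d2).
  rewrite norm_sub_comm. apply (ball_convex (xt t)); try easy; rewrite norm_sub_comm;
    [apply H1|apply H2]; lra.
Qed.

(** T (x_t) approaches x_t as t -> 0+, so |x_t - T z| is at most |T x_t - T z| <= |x_t - z| plus a
    vanishing error. *)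
Lemma limsup_le_image p r z : fixed_point D T p -> limsup_le r z -> limsup_le r (T z).
Proof.
  intros Hp [Hz Hz']. split; [auto|]. intros r' Hr'.
  destruct (Hz' ((r + r') / 2) ltac:(lra)) as [d [Hd H]].
  set (b := ⟦u -v p⟧). assert (Hb : 0 <= b) by apply ns_norm_ge0.
  set (c := (r' - r) / 2 / (2 * b + 1)).
  assert (Hc : c * (2 * b + 1) = (r' - r) / 2) by (unfold c; field; lra).
  assert (Hc0 : 0 < c) by (apply Rdiv_lt_0_compat; lra).
  exists (Rmin d (Rmin c 1)). split; [repeat apply Rmin_glb_lt; lra|]. intros t Ht.
  assert (A1 := Rmin_l d (Rmin c 1)). assert (A2 := Rmin_r d (Rmin c 1)).
  assert (A3 := Rmin_l c 1). assert (A4 := Rmin_r c 1).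
  assert (Ht1 : 0 < t < 1) by lra. specialize (H t ltac:(lra)).
  assert (B := path_almost_fixed p t Hp Ht1). fold b in B.
  assert (F := HTne _ _ (proj1 (Hxt t Ht1)) Hz).
  assert (G := norm_sub_trans (T (xt t)) (xt t) (T z)).
  rewrite (norm_sub_comm (xt t) (T (xt t))) in G.
  assert (t * (2 * b) <= c * (2 * b)) by (apply Rmult_le_compat_r; lra). lra.
Qed.

(* With [d] the least asymptotic radius of the path and [p] a fixed point at
   which it is attained, [a = xt t - p] and [w = u - p] satisfy [|a + r w| >= (1 + r) |a|]
   by the defining equation of [xt t], and [|a - r w| >= d] up to a small error for
   some small [t] because [p + r w] is no better centre than [p].
   By smoothness [d = 0]. *)
Theorem path_converges p0 : fixed_point D T p0 ->
  exists q, fixed_point D T q /\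
    forall eps, eps > 0 -> exists d, d > 0 /\ forall t, 0 < t < d -> ⟦xt t -v q⟧ < eps.
Proof.
  intro Hp0.
  destruct (infimum (fun r => 0 <= r /\ exists z, limsup_le r z)) as [d [Hd0 [Hlow Happ]]].
  { exists (⟦u -v p0⟧). split; [apply ns_norm_ge0|]. exists p0. split; [apply Hp0|].
    intros r' Hr'. exists 1. split; [lra|]. intros t Ht.
    assert (A := path_bounded p0 t Hp0 Ht). lra. }
  { now intros r [Hr _]. }
  pose (C := fun n => limsup_le (d + / INR (S n))).
  assert (Hmono : forall r r' z, r <= r' -> limsup_le r z -> limsup_le r' z).
  { intros r r' z Hr [Hz H]. split; [easy|]. intros r'' Hr''. apply H. lra. }
  assert (HCb : forall z, C 0%nat z -> ⟦z -v p0⟧ <= d + 2 + ⟦u -v p0⟧).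
  { intros z [Hz H]. destruct (H (d + 2)) as [del [Hdel H']]; [simpl; lra|].
    set (t := Rmin del 1 / 2).
    assert (A := Rmin_l del 1). assert (B := Rmin_r del 1).
    assert (F : 0 < Rmin del 1) by (apply Rmin_glb_lt; lra).
    specialize (H' t ltac:(unfold t; lra)).
    assert (G := path_bounded p0 t Hp0 ltac:(unfold t; lra)).
    assert (I := norm_sub_trans (xt t) z p0). rewrite (norm_sub_comm z (xt t)) in I. lra. }
  assert (HCne : exists z, forall n, C n z).
  { apply (nested_inter Hus HE C p0 (d + 2 + ⟦u -v p0⟧)); try easy.
    - intro n. destruct (Happ _ (inv_INR_pos n)) as [r [[_ [z Hz]] Hr]].
      exists z. apply (Hmono r); [lra|easy].
    - intros n z. apply Hmono. assert (A := inv_INR_le n (S n) ltac:(lia)). lra.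
    - intro n. apply limsup_le_convex.
    - intro n. apply limsup_le_closed. }
  destruct (nonexpansive_fixed_point HE Hus (fun z => forall n, C n z) T
              (2 * (d + 2 + ⟦u -v p0⟧))) as [p [HpC HTp]].
  { split; [easy|split; [|split]].
    - intros s l Hs Hl n. apply (limsup_le_closed _ s); [intro k; apply Hs|easy].
    - intros x y t Hx Hy Ht n. apply limsup_le_convex; [apply Hx|apply Hy|easy].
    - intros x Hx n. apply (limsup_le_image p0); [easy|apply Hx]. }
  { intros x y Hx Hy. apply HTne; [apply (Hx 0%nat)|apply (Hy 0%nat)]. }
  { intros x y Hx Hy. assert (A := HCb x (Hx 0%nat)). assert (B := HCb y (Hy 0%nat)).
    assert (F := norm_sub_trans p0 x y). rewrite (norm_sub_comm p0) in F. lra. }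
  assert (Hp : D p) by apply (HpC 0%nat).
  assert (Hev : forall r', d < r' -> exists e, e > 0 /\ forall t, 0 < t < e -> ⟦xt t -v p⟧ <= r').
  { intros r' Hr'. destruct (inv_INR_lt (r' - d) ltac:(lra)) as [n Hn].
    apply (HpC n). lra. }
  clear HCne HpC HCb. clearbody C. clear C.
  exists p. split; [easy|].
  destruct (Rle_lt_dec d 0) as [Hd|Hd].
  { intros eps Heps. destruct (Hev (eps / 2) ltac:(lra)) as [e [He H]].
    exists e. split; [easy|]. intros t Ht. specialize (H t Ht). lra. }
  exfalso.
  set (W := ⟦u -v p⟧). assert (HW : 0 <= W) by apply ns_norm_ge0.
  set (ep := d / (8 * (W + 1))).
  assert (Hep : ep * (8 * (W + 1)) = d) by (unfold ep; field; lra).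
  assert (Hep0 : 0 < ep) by (apply Rdiv_lt_0_compat; lra). clearbody ep.
  destruct (smooth_le Hus ep Hep0) as [del [Hdel Hsm]].
  (* r W <= d/4 keeps |xt t - p| above d/2 by the triangle inequality; r W <= del (d/2) then makes r
     (u - p) admissible in [Hsm]. *)
  assert (Hr : exists r, 0 < r <= 1 /\ r * W <= d / 4 /\ r * W <= del * (d / 2)).
  { set (r1 := d / (4 * (W + 1))). set (r2 := del * d / (2 * (W + 1))).
    assert (E1 : r1 * (4 * (W + 1)) = d) by (unfold r1; field; lra).
    assert (E2 : r2 * (2 * (W + 1)) = del * d) by (unfold r2; field; lra).
    assert (P1 : 0 < r1) by (apply Rdiv_lt_0_compat; lra).
    assert (P2 : 0 < r2) by (apply Rdiv_lt_0_compat; nra).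
    clearbody r1 r2. exists (Rmin 1 (Rmin r1 r2)).
    assert (A1 := Rmin_l 1 (Rmin r1 r2)). assert (A2 := Rmin_r 1 (Rmin r1 r2)).
    assert (A3 := Rmin_l r1 r2). assert (A4 := Rmin_r r1 r2).
    assert (A5 : 0 < Rmin 1 (Rmin r1 r2)) by (repeat apply Rmin_glb_lt; lra).
    set (r := Rmin 1 (Rmin r1 r2)) in *.
    assert (r * W <= r1 * W) by (apply Rmult_le_compat_r; lra).
    assert (r * W <= r2 * W) by (apply Rmult_le_compat_r; lra). lra. }
  destruct Hr as [r [[Hr0 Hr1] [Hr2 Hr3]]].
  set (eta := r * d / 16). assert (Heta : 0 < eta) by (unfold eta; nra).
  assert (Heta1 : eta <= d / 16) by (unfold eta; nra).
  set (z := r *v u +v (1 - r) *v p).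
  assert (Hz : D z) by (apply HDcv; auto; lra).
  (* Otherwise [z] would have asymptotic radius at most [d - eta], below the infimum. *)
  assert (Hfreq : forall e, e > 0 -> exists t, 0 < t < e /\ d - eta < ⟦xt t -v z⟧).
  { intros e He. apply NNPP. intro Hn.
    enough (d <= d - eta) by lra. apply Hlow. split; [lra|]. exists z. split; [easy|].
    intros r' Hr'. exists e. split; [easy|]. intros t Ht. apply Rnot_lt_le. intro Hlt.
    apply Hn. exists t. split; [easy|lra]. }
  destruct (Hev (d + eta) ltac:(lra)) as [e [He Hev']].
  destruct (Hfreq (Rmin e 1)) as [t [Ht Hminus]]; [apply Rmin_glb_lt; lra|].
  assert (A1 := Rmin_l e 1). assert (A2 := Rmin_r e 1).
  specialize (Hev' t ltac:(lra)). assert (Ht1 : 0 < t < 1) by lra.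
  replace (xt t -v z) with ((xt t -v p) -v r *v (u -v p)) in Hminus by (unfold z; vec).
  assert (HTa := HTne _ _ (proj1 (Hxt t Ht1)) Hp). rewrite HTp in HTa.
  (* Adding r times the equation of the path to t (xt t - p) isolates a + r w; bounding |T (xt t) -
     p| by |a| and cancelling leaves (1 + r) |a| <= |a + r w|. *)
  assert (Hplus := norm_comb ((r + t) *v (xt t -v p)) (T (xt t) -v p)
    ((xt t -v p) +v r *v (u -v p)) (r * (1 - t)) t ltac:(nra) ltac:(lra)).
  rewrite norm_scal in Hplus by lra.
  assert (Heq : (r + t) *v (xt t -v p) =
    (r * (1 - t)) *v (T (xt t) -v p) +v t *v ((xt t -v p) +v r *v (u -v p))).
  { replace ((r + t) *v (xt t -v p)) with (r *v (xt t -v p) +v t *v (xt t -v p)) by vec.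
    rewrite (path_sub t p Ht1) at 1. vec. }
  specialize (Hplus Heq). clear Heq.
  specialize (Hsm (xt t -v p) (r *v (u -v p))).
  assert (Htri := norm_comb ((xt t -v p) -v r *v (u -v p)) (xt t -v p) (p -v u) 1 r
    ltac:(lra) ltac:(lra) ltac:(vec)).
  rewrite (norm_sub_comm p u) in Htri. rewrite norm_scal in Hsm by lra.
  fold W in Hsm, Htri. set (a := ⟦xt t -v p⟧) in *.
  assert (Hplus' : (1 + r) * a <= ⟦(xt t -v p) +v r *v (u -v p)⟧).
  { apply (Rmult_le_reg_l t); [lra|].
    assert (r * (1 - t) * ⟦T (xt t) -v p⟧ <= r * (1 - t) * a)
      by (apply Rmult_le_compat_l; nra). lra. }
  specialize (Hsm ltac:(nra)).
  assert (r * (ep * (8 * W)) <= r * d) by (apply Rmult_le_compat_l; nra).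
  assert (r * (11 * d / 16) <= r * a) by (apply Rmult_le_compat_l; lra).
  assert (r * d > 0) by nra. unfold eta in *. lra.
Qed.

(* If [q] is the limit of the path, the upper limit of [<u - q, J (x n - q)>] is
   nonpositive for the duality map [J]; stated through the norm. *)
Lemma limit_direction q (x : nat -> E) :
  (forall eps, eps > 0 -> exists d, d > 0 /\ forall t, 0 < t < d -> ⟦xt t -v q⟧ < eps) ->
  (forall n, D (x n)) -> Un_cv (fun n => ⟦T (x n) -v x n⟧) 0 ->
  forall r k, 0 < r <= 1 -> k > 0 ->
  exists N, forall n, (N <= n)%nat -> ⟦x n -v q⟧ - k <= ⟦(x n -v q) -v r *v (u -v q)⟧.
Proof.
  intros Hq Hx HTx r k Hr Hk.
  destruct (Hq (k / 4) ltac:(lra)) as [d [Hd Hqd]].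
  set (t := Rmin d 1 / 2).
  assert (Ht : 0 < t < d /\ t < 1).
  { assert (A := Rmin_l d 1). assert (B := Rmin_r d 1).
    assert (F : 0 < Rmin d 1) by (apply Rmin_glb_lt; lra). unfold t; lra. }
  clearbody t. specialize (Hqd t ltac:(lra)). assert (Ht1 : 0 < t < 1) by lra.
  (* [t] is fixed before [n], so this error survives the later division by [t]. *)
  destruct (HTx (t * k / 4)) as [N HN]; [nra|]. exists N. intros n Hn.
  specialize (HN n Hn). unfold Rdist in HN.
  rewrite Rminus_0_r, Rabs_pos_eq in HN by apply ns_norm_ge0.
  assert (A := HTne _ _ (Hx n) (proj1 (Hxt t Ht1))).
  assert (B := norm_sub_trans (T (x n)) (x n) (T (xt t))). 
  rewrite (norm_sub_comm (x n) (T (x n))) in B.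
  (* The path equation is used with [x n] in the role of an approximate fixed point: it gives |x n -
     xt t| <= |(x n - xt t) - r (u - xt t)| + k/4. Replacing [xt t] by [q] costs at most k/2
     more. *)
  assert (F := norm_comb ((r * (1 - t) + t) *v (x n -v xt t)) (x n -v T (xt t))
    ((x n -v xt t) -v r *v (u -v xt t)) (r * (1 - t)) t ltac:(nra) ltac:(lra)).
  rewrite norm_scal in F by nra.
  assert (Heq : (r * (1 - t) + t) *v (x n -v xt t) =
    (r * (1 - t)) *v (x n -v T (xt t)) +v t *v ((x n -v xt t) -v r *v (u -v xt t))).
  { replace ((r * (1 - t)) *v (x n -v T (xt t)) +v t *v ((x n -v xt t) -v r *v (u -v xt t)))
      with ((r * (1 - t) + t) *v (x n -v xt t)
        +v r *v (xt t -v (t *v u +v (1 - t) *v T (xt t)))) by vec.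
    rewrite <- (proj2 (Hxt t Ht1)). vec. }
  specialize (F Heq).
  assert (G' := norm_comb (((x n -v xt t) -v r *v (u -v xt t))) ((x n -v q) -v r *v (u -v q))
    (q -v xt t) 1 (1 - r) ltac:(lra) ltac:(lra) ltac:(vec)).
  rewrite (norm_sub_comm q) in G'.
  assert (I := norm_sub_trans (xt t) (x n) q).
  set (m := ⟦(x n -v xt t) -v r *v (u -v xt t)⟧) in *.
  set (b := ⟦x n -v xt t⟧) in *. set (rn := ⟦T (x n) -v x n⟧) in *.
  assert (Hrn : 0 <= rn) by apply ns_norm_ge0.
  assert (H1 : r * (1 - t) * ⟦x n -v T (xt t)⟧ <= r * (1 - t) * (rn + b))
    by (apply Rmult_le_compat_l; nra).
  assert (H2 : r * (1 - t) * rn <= 1 * rn) by (apply Rmult_le_compat_r; nra).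
  assert (H3 : b <= k / 4 + m) by (apply (Rmult_le_reg_l t); lra).
  assert (H4 : (1 - r) * ⟦xt t -v q⟧ <= 1 * ⟦xt t -v q⟧)
    by (apply Rmult_le_compat_r; [apply ns_norm_ge0|lra]).
  lra.
Qed.

End Path.

(** * The iteration *)

(** Divergence of the sum of [a] forces p below eta/2 at some late index, since otherwise p would
    become negative; from there on p grows by at most a tail of the sum of [c], which is below
    eta/2. *)
Lemma recurrence_vanish (p a c : nat -> R) (N0 : nat) (l : R) :
  (forall n, 0 <= p n) -> (forall n, 0 <= a n <= 1) -> (forall n, 0 <= c n) ->
  (forall n, (N0 <= n)%nat -> p (S n) <= (1 - a n) * p n + c n) ->
  cv_infty (fun n => sum_f_R0 a n) -> Un_cv (fun n => sum_f_R0 c n) l ->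
  forall eta, eta > 0 -> exists N, forall n, (N <= n)%nat -> p n < eta.
Proof.
  intros Hp Ha Hc Hrec Hdiv Hcv eta Heta.
  destruct (Hcv (eta / 4) ltac:(lra)) as [N1 HN1].
  assert (Htail : forall n m, (N1 <= n)%nat -> (N1 <= m)%nat ->
     sum_f_R0 c n - sum_f_R0 c m < eta / 2).
  { intros n m Hn Hm. apply HN1, Rabs_def2 in Hn. apply HN1, Rabs_def2 in Hm. lra. }
  set (N := Nat.max N0 N1).
  assert (Hex : exists k, (N <= k)%nat /\ p (S k) < eta / 2).
  { apply NNPP. intro Hn.
    assert (Hbig : forall k, (N <= k)%nat -> eta / 2 <= p (S k)).
    { intros k Hk. apply Rnot_lt_le. intro. apply Hn. now exists k. }
    assert (Hsum : forall j, p (S (N + j)) + eta / 2 * (sum_f_R0 a (N + j) - sum_f_R0 a N)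
       <= p (S N) + (sum_f_R0 c (N + j) - sum_f_R0 c N)).
    { induction j as [|j IH].
      - rewrite Nat.add_0_r. lra.
      - rewrite Nat.add_succ_r. simpl sum_f_R0.
        assert (A := Hrec (S (N + j)) ltac:(lia)). assert (B := Hbig (N + j)%nat ltac:(lia)).
        assert (a (S (N + j)) * (eta / 2) <= a (S (N + j)) * p (S (N + j)))
          by (apply Rmult_le_compat_l; [apply Ha|easy]). lra. }
    destruct (Hdiv (sum_f_R0 a N + (p (S N) + eta) / (eta / 2))) as [N2 HN2].
    specialize (HN2 (N + N2)%nat ltac:(lia)). specialize (Hsum N2).
    assert (A := Htail (N + N2)%nat N ltac:(lia) ltac:(lia)).
    assert (B := Hp (S (N + N2))).
    assert (D : (p (S N) + eta) / (eta / 2) < sum_f_R0 a (N + N2) - sum_f_R0 a N) by lra.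
    apply (Rmult_lt_compat_l (eta / 2)) in D; [|lra].
    replace (eta / 2 * ((p (S N) + eta) / (eta / 2))) with (p (S N) + eta) in D by (field; lra).
    lra. }
  destruct Hex as [k [Hk Hpk]].
  exists (S k). intros n Hn.
  assert (Hdec : forall j, p (S (k + j)) <= p (S k) + (sum_f_R0 c (k + j) - sum_f_R0 c k)).
  { induction j as [|j IH].
    - rewrite Nat.add_0_r. lra.
    - rewrite Nat.add_succ_r. simpl sum_f_R0.
      assert (A := Hrec (S (k + j)) ltac:(lia)).
      assert (0 <= a (S (k + j)) * p (S (k + j))) by (apply Rmult_le_pos; [apply Ha|apply Hp]).
      lra. }
  specialize (Hdec (n - S k)%nat). replace (S (k + (n - S k))) with n in Hdec by lia.
  assert (A := Htail (k + (n - S k))%nat k ltac:(lia) ltac:(lia)). lra.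
Qed.

Lemma convex_comb3 {E : NormedSpace} (D : E -> Prop) (x y z : E) (a b c : R) :
  ns_convex_set D -> D x -> D y -> D z -> 0 <= a -> 0 <= b -> 0 <= c -> a + b + c = 1 ->
  D (a *v x +v b *v y +v c *v z).
Proof.
  intros HD Hx Hy Hz Ha Hb Hc Hs.
  destruct (Req_dec c 1) as [Hc1|Hc1].
  - assert (a = 0) as -> by lra. assert (b = 0) as -> by lra. subst c.
    replace (0 *v x +v 0 *v y +v 1 *v z) with z by vec. easy.
  - assert (Hac : 0 <= a / (1 - c) <= 1).
    { assert (0 < / (1 - c)) by (apply Rinv_0_lt_compat; lra).
      split; [apply Rmult_le_pos; lra|].
      apply (Rmult_le_reg_r (1 - c)); [lra|]. unfold Rdiv. rewrite Rmult_assoc, Rinv_l by lra. lra. }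
    replace b with (1 - c - a) by lra.
    replace (a *v x +v (1 - c - a) *v y +v c *v z)
      with ((1 - c) *v (a / (1 - c) *v x +v (1 - a / (1 - c)) *v y) +v (1 - (1 - c)) *v z) by vec.
    apply HD; [apply HD; easy|easy|lra].
Qed.

Lemma norm_comb3 {E : NormedSpace} (x y z w : E) a b c :
  0 <= a -> 0 <= b -> 0 <= c -> x = a *v y +v b *v z +v c *v w ->
  ⟦x⟧ <= a * ⟦y⟧ + b * ⟦z⟧ + c * ⟦w⟧.
Proof.
  intros Ha Hb Hc ->.
  assert (A := norm_comb (a *v y +v b *v z +v c *v w) (a *v y +v b *v z) w 1 c
                 ltac:(lra) Hc ltac:(vec)).
  assert (B := norm_comb (a *v y +v b *v z) y z a b Ha Hb eq_refl). lra.
Qed.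

(* If [A] is not small and the one-sided derivative of the norm at [A] along [w] is
   almost nonpositive, then removing [s w] from [A] hardly decreases the norm. *)
Lemma norm_le_remove {E : NormedSpace} (Hus : uniformly_smooth E) (w : E) (theta : R) :
  theta > 0 -> exists r k, 0 < r <= 1 /\ k > 0 /\
  forall (A : E) (s : R), 0 <= s -> theta <= ⟦A⟧ -> ⟦A⟧ - k <= ⟦A -v r *v w⟧ ->
    ⟦A⟧ <= ⟦A -v s *v w⟧ + s * theta.
Proof.
  intro Hth. set (W := ⟦w⟧). assert (HW : 0 <= W) by apply ns_norm_ge0.
  set (ep := theta / (2 * (W + 1))).
  assert (Hep : ep * (2 * (W + 1)) = theta) by (unfold ep; field; lra).
  assert (Hep0 : 0 < ep) by (apply Rdiv_lt_0_compat; lra). clearbody ep.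
  destruct (smooth_le Hus ep Hep0) as [del [Hdel Hsm]].
  set (r1 := del * theta / (W + 1)).
  assert (E1 : r1 * (W + 1) = del * theta) by (unfold r1; field; lra).
  assert (P1 : 0 < r1) by (apply Rdiv_lt_0_compat; nra). clearbody r1.
  set (r := Rmin 1 r1).
  assert (Hr : 0 < r <= 1 /\ r <= r1).
  { assert (A1 := Rmin_l 1 r1). assert (A2 := Rmin_r 1 r1).
    assert (A3 : 0 < Rmin 1 r1) by (apply Rmin_glb_lt; lra). unfold r; lra. }
  destruct Hr as [Hr Hr1]. clearbody r.
  (* With this slack, smoothness yields |A + r w| <= |A| + r theta, uniformly in A. *)
  exists r, (r * theta / 2). split; [easy|split; [nra|]].
  intros A s Hs HA Hdir.
  specialize (Hsm A (r *v w)). rewrite norm_scal in Hsm by lra. fold W in Hsm.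
  assert (r * W <= del * theta).
  { assert (r * W <= r1 * W) by (apply Rmult_le_compat_r; lra). lra. }
  assert (del * theta <= del * ⟦A⟧) by (apply Rmult_le_compat_l; lra).
  specialize (Hsm ltac:(lra)).
  (* A is a weighted mean of A - s w and A + r w, so a bound on the latter bounds |A| through the
     former. *)
  assert (F := norm_comb ((r + s) *v A) (A -v s *v w) (A +v r *v w) r s ltac:(lra) Hs ltac:(vec)).
  rewrite norm_scal in F by lra.
  assert (ep * (r * W) <= r * theta / 2).
  { replace (ep * (r * W)) with (r * (ep * W)) by ring.
    assert (ep * W <= theta / 2) by lra. nra. }
  assert (s * ⟦A +v r *v w⟧ <= s * (⟦A⟧ + r * theta)) by (apply Rmult_le_compat_l; lra).
  apply (Rmult_le_reg_l r); lra.
Qed.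

Theorem theorem3p2
  (E : NormedSpace) (HE : complete E) (Hus : uniformly_smooth E)
  (D : E -> Prop) (HDne : exists z, D z) (HDcl : ns_closed_set D) (HDcv : ns_convex_set D)
  (T : E -> E) (HTD : forall x, D x -> D (T x)) (HTne : nonexpansive_on D T)
  (HF : exists p, fixed_point D T p)
  (u : E) (Hu : D u)
  (us vs : nat -> E) (Hus_D : forall n, D (us n)) (Hvs_D : forall n, D (vs n))
  (Hus_b : bounded_seq us) (Hvs_b : bounded_seq vs)
  (alpha gamma beta delta : nat -> R)
  (Ha0 : forall n, 0 <= alpha n) (Hg0 : forall n, 0 <= gamma n)
  (Hb0 : forall n, 0 <= beta n) (Hd0 : forall n, 0 <= delta n)
  (Hag : forall n, 0 < alpha n + gamma n <= 1)
  (Hbd : forall n, 0 < beta n + delta n <= 1)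
  (Ha_cv : Un_cv alpha 0)
  (Ha_sum : cv_infty (fun n => sum_f_R0 alpha n))
  (Hg_sum : exists l, Un_cv (fun n => sum_f_R0 gamma n) l)
  (Hd_sum : exists l, Un_cv (fun n => sum_f_R0 delta n) l)
  (Hga : Un_cv (fun n => gamma n / (alpha n + gamma n)) 0)
  (x y : nat -> E) (Hx0 : D (x 0%nat))
  (Hy : forall n, y n = ns_add (ns_add (ns_scal (beta n) (x n))
                                       (ns_scal (1 - beta n - delta n) (T (x n))))
                               (ns_scal (delta n) (vs n)))
  (Hx : forall n, x (S n) = ns_add (ns_add (ns_scal (alpha n) u)
                                           (ns_scal (1 - alpha n - gamma n) (T (y n))))
                                   (ns_scal (gamma n) (us n)))
  (Hxb : bounded_seq x)
  (HTx : Un_cv (fun n => ns_norm (ns_sub (T (x n)) (x n))) 0)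
  (* x_t : the (unique) solution of x_t = t u + (1-t) T x_t in D, t in (0,1),
     for the constant contraction f = u *)
  (xt : R -> E)
  (Hxt : forall t, 0 < t < 1 ->
           D (xt t) /\ xt t = ns_add (ns_scal t u) (ns_scal (1 - t) (T (xt t)))) :
  exists q : E,
    (* q = Q(u) := lim_{t -> 0+} x_t *)
    (forall eps, eps > 0 -> exists d, d > 0 /\
        forall t, 0 < t < d -> ns_norm (ns_sub (xt t) q) < eps)
    /\ seq_cv x q.
Proof.
  destruct HF as [p0 Hp0].
  destruct (path_converges HE Hus D HDcl HDcv T HTD HTne u Hu xt Hxt p0 Hp0) as [q [[Hq HTq] Hlim]].
  exists q. split; [exact Hlim|].
  assert (HxyD : forall n, D (x n) -> D (y n)).
  { intros n Hn. rewrite Hy. specialize (Hbd n). specialize (Hb0 n). specialize (Hd0 n).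
    apply convex_comb3; auto; lra. }
  assert (HxD : forall n, D (x n)).
  { induction n as [|n IH]; [easy|]. rewrite Hx.
    specialize (Hag n). specialize (Ha0 n). specialize (Hg0 n).
    apply convex_comb3; auto; lra. }
  destruct Hus_b as [M1 HM1]. destruct Hvs_b as [M2 HM2].
  assert (Hbnd : exists M, forall n, ⟦us n -v q⟧ <= M /\ ⟦vs n -v q⟧ <= M).
  { exists (Rmax M1 M2 + ⟦q⟧). intro n.
    assert (A1 := Rmax_l M1 M2). assert (A2 := Rmax_r M1 M2).
    specialize (HM1 n). specialize (HM2 n).
    assert (B1 := norm_sub_trans ns_zero (us n) q). assert (B2 := norm_sub_trans ns_zero (vs n) q).
    rewrite (norm_sub_comm ns_zero) in B1, B2.
    replace (us n -v ns_zero) with (us n) in B1 by vec.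
    replace (vs n -v ns_zero) with (vs n) in B2 by vec.
    replace (q -v ns_zero) with q in B1, B2 by vec. lra. }
  destruct Hbnd as [M HM].
  assert (HM0 : 0 <= M).
  { eapply Rle_trans; [apply ns_norm_ge0|apply (HM 0%nat)]. }
  assert (Hstep : forall n, ⟦x (S n) -v q -v alpha n *v (u -v q)⟧
     <= (1 - alpha n) * ⟦x n -v q⟧ + (delta n + gamma n) * M).
  { intro n. specialize (Hag n). specialize (Ha0 n). specialize (Hg0 n).
    specialize (Hbd n). specialize (Hb0 n). specialize (Hd0 n). destruct (HM n) as [HMu HMv].
    (* As the coefficients sum to 1, subtracting alpha n (u - q) leaves only the terms of [T (y n)]
       and [us n]. *)
    assert (A := norm_comb (x (S n) -v q -v alpha n *v (u -v q)) (T (y n) -v q) (us n -v q)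
      (1 - alpha n - gamma n) (gamma n) ltac:(lra) ltac:(lra) ltac:(rewrite Hx; vec)).
    assert (B := HTne _ _ (HxyD n (HxD n)) Hq). rewrite HTq in B.
    assert (C := norm_comb3 (y n -v q) (x n -v q) (T (x n) -v q) (vs n -v q)
      (beta n) (1 - beta n - delta n) (delta n) ltac:(lra) ltac:(lra) ltac:(lra)
      ltac:(rewrite Hy; vec)).
    assert (F := HTne _ _ (HxD n) Hq). rewrite HTq in F.
    set (s := ⟦x n -v q⟧) in *. assert (Hs : 0 <= s) by apply ns_norm_ge0.
    assert (Hy1 : ⟦y n -v q⟧ <= s + delta n * M) by nra.
    assert (H1 : (1 - alpha n - gamma n) * ⟦T (y n) -v q⟧
       <= (1 - alpha n - gamma n) * (s + delta n * M)) by (apply Rmult_le_compat_l; lra).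
    assert (H2 : gamma n * ⟦us n -v q⟧ <= gamma n * M) by (apply Rmult_le_compat_l; lra).
    assert (H3 : 0 <= (alpha n + gamma n) * (delta n * M)) by (repeat apply Rmult_le_pos; lra).
    assert (H4 : 0 <= gamma n * s) by (apply Rmult_le_pos; lra).
    lra. }
  intros eps Heps. set (theta := eps / 2).
  destruct (norm_le_remove Hus (u -v q) theta) as [r [k [Hr [Hk Hrem]]]]; [unfold theta; lra|].
  destruct (limit_direction D T HTne u xt Hxt q x Hlim HxD HTx r k Hr Hk) as [N0 HN0].
  destruct Hg_sum as [lg Hg_sum]. destruct Hd_sum as [ld Hd_sum].
  (* The recurrence is run on the part of |x n - q| above [theta], since [Hrem] needs the norm to be
     at least [theta]; below that level the positive part is simply 0. *)
  destruct (recurrence_vanish (fun n => Rmax 0 (⟦x n -v q⟧ - theta)) alpha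
    (fun n => (delta n + gamma n) * M) N0 (M * (ld + lg))) with (eta := theta) as [N HN].
  - intro n. apply Rmax_l.
  - intro n. specialize (Ha0 n). specialize (Hg0 n). specialize (Hag n). lra.
  - intro n. specialize (Hd0 n). specialize (Hg0 n). apply Rmult_le_pos; lra.
  - intros n Hn. specialize (Ha0 n). specialize (Hg0 n). specialize (Hag n). specialize (Hd0 n).
    assert (A1 := Rmax_l 0 (⟦x n -v q⟧ - theta)). assert (A2 := Rmax_r 0 (⟦x n -v q⟧ - theta)).
    set (m := Rmax 0 (⟦x n -v q⟧ - theta)) in *.
    assert (B1 : 0 <= (delta n + gamma n) * M) by (apply Rmult_le_pos; lra).
    assert (B2 : 0 <= (1 - alpha n) * m) by (apply Rmult_le_pos; lra).
    assert (B3 : (1 - alpha n) * (⟦x n -v q⟧ - theta) <= (1 - alpha n) * m)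
      by (apply Rmult_le_compat_l; lra).
    apply Rmax_lub; [lra|].
    destruct (Rle_lt_dec theta (⟦x (S n) -v q⟧)) as [Hth|Hth]; [|lra].
    (* The extra term alpha n theta is exactly what lets [theta] be subtracted on both sides of the
       recurrence. *)
    assert (C := Hrem _ (alpha n) Ha0 Hth (HN0 (S n) ltac:(lia))).
    specialize (Hstep n). lra.
  - exact Ha_sum.
  - apply (Un_cv_ext (fun n => M * (sum_f_R0 delta n + sum_f_R0 gamma n))).
    + intro n. rewrite <- sum_plus, scal_sum. apply sum_eq. intros; ring.
    + apply (CV_mult (fun _ => M)); [|now apply CV_plus].
      intros e He. exists 0%nat. intros n _. unfold Rdist. rewrite Rminus_diag, Rabs_R0. easy.
  - unfold theta; lra.
  - exists N. intros n Hn. specialize (HN n Hn). simpl in HN.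
    assert (A := Rmax_r 0 (⟦x n -v q⟧ - theta)). unfold theta in *. lra.
Qed.
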